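(* Let $\mathcal{F}=((X,d),(f_i)_{i\in I})$ be a generalized possibly infinite iterated function system of order $m\in\mathbb{N}^*$. Then $\mathrm{lip}(H_{\mathcal{F}})\le\sup_{i\in I}\mathrm{lip}(f_i)$. In particular, if $\sup_{i\in I}\mathrm{lip}(f_i)<1$, then the operator $H_{\mathcal{F}}:\mathcal{C}^m\to\mathcal{C}$ is a contraction (i.e. $\mathrm{lip}(H_{\mathcal{F}})<1$).
   Context: $\mathbb{N}^{*}=\{1,2,\dots\}$. The sets $X$ and $I$ are nonempty. For a metric space $(Y,\rho)$ and $m\in\mathbb{N}^*$, $Y^m$ carries the maximum metric $\rho_{\max}((x_1,\dots,x_m),(y_1,\dots,y_m))=\max_j \rho(x_j,y_j)$. For a map $f:Y^m\to Y$, $\mathrm{lip}(f)\in[0,\infty]$ denotes its least Lipschitz constant with respect to $\rho_{\max}$ and $\rho$ ($+\infty$ if $f$ is not Lipschitz). A generalized possibly infinite iterated function system of order $m$ is a pair $\mathcal{F}=((X,d),(f_i)_{i\in I})$, where $(X,d)$ is a metric space, each $f_i:X^m\to X$ is continuous, and the family $(f_i)_{i\in I}$ is bounded, i.e. $\bigcup_{i\in I}f_i(B)$ is bounded for every bounded $B\subseteq X^m$. Code space: $\Omega_1=I$, $\Omega_{k+1}=\Omega_k\times\dots\times\Omega_k$ ($m$ times), and $\Omega=\Omega_1\times\Omega_2\times\cdots$. Elements of $\Omega$ are written $\alpha=\alpha^1\alpha^2\dots\alpha^k\dots$ with $\alpha^k\in\Omega_k$; for $k\ge2$ write $\alpha^k=\alpha^k_1\alpha^k_2\dots\alpha^k_m$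 with $\alpha^k_i\in\Omega_{k-1}$, and for $i\in\{1,\dots,m\}$ put $\alpha(i)=\alpha^2_i\alpha^3_i\alpha^4_i\dots\in\Omega$. $\Omega$ is endowed with the metric $d(\alpha,\beta)=\sum_{k\ge1}c^k\,\delta(\alpha^k,\beta^k)$, where $c\in(0,1)$ is fixed and $\delta(\alpha^k,\beta^k)$ is $1$ if $\alpha^k\neq\beta^k$ and $0$ otherwise. $\mathcal{C}$ is the set of continuous bounded functions $f:\Omega\to X$ with the metric $d_u(f,g)=\sup_{\alpha\in\Omega}d(f(\alpha),g(\alpha))$; $\mathcal{C}^m$ carries the corresponding maximum metric. The operator $H_{\mathcal{F}}:\mathcal{C}^m\to\mathcal{C}$ is $H_{\mathcal{F}}(g_1,\dots,g_m)(\alpha)=f_{\alpha^1}(g_1(\alpha(1)),\dots,g_m(\alpha(m)))$ for $\alpha=\alpha^1\alpha^2\dots\in\Omega$. *)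

(* Defs.v *)
From HB Require Import structures.
From mathcomp Require Import all_boot all_order all_algebra.
From mathcomp Require Import all_classical all_reals all_analysis.

Set Implicit Arguments.
Unset Strict Implicit.
Unset Printing Implicit Defensive.

Import Order.TTheory GRing.Theory Num.Theory.
Import numFieldNormedType.Exports.
Import metricType_numDomainType.

Local Open Scope classical_set_scope.
Local Open Scope ring_scope.

Definition metric_bounded (R : realType) (Y : metricType R) (A : set Y) : Prop :=
  exists M : R, forall x y, A x -> A y -> mdist x y <= M.

(* The infimum of the Lipschitz constants is itself a Lipschitz constant when
   there is one; otherwise it is [ereal_inf set0 = +oo]. *)
Definition lip (R : realType) (Y Z : metricType R) (f : Y -> Z) : \bar R :=
  ereal_inf [set k%:E | k in [set k : R |
    0 <= k /\ forall x y, mdist (f x) (f y) <= k * mdist x y]].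

Lemma metric_continuousP (R : realType) (Y Z : metricType R) (f : Y -> Z) (x : Y) :
  {for x, continuous f} <->
  forall e : R, 0 < e -> \forall y \near x, mdist (f x) (f y) < e.
Proof. exact: cvgrPdist_lt. Qed.

(* A synonym of [{ffun 'I_m -> Y}], made a metric space by the maximum metric.
   The distances are nonnegative, so the unit 0 of the maximum only matters
   for m = 0. *)
Definition mpow (m : nat) (Y : Type) : Type := {ffun 'I_m -> Y}.

Section mpow_metric.
Context (R : realType) (m : nat) (Y : metricType R).

HB.instance Definition _ := Choice.copy (mpow m Y) {ffun 'I_m -> Y}.

Definition mpow_dist (x y : mpow m Y) : R :=
  \big[Num.max/0]_(j < m) mdist (x j) (y j).

Lemma mpow_dist_ge (x y : mpow m Y) j : mdist (x j) (y j) <= mpow_dist x y.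
Proof. exact: (le_bigmax _ (fun j => mdist (x j) (y j))). Qed.

Lemma mpow_dist_le (x y : mpow m Y) (r : R) : 0 <= r ->
  (forall j, mdist (x j) (y j) <= r) -> mpow_dist x y <= r.
Proof. by move=> r0 h; apply: bigmax_le => // j _; exact: h. Qed.

Lemma mpow_dist_lt (x y : mpow m Y) (r : R) : 0 < r ->
  (forall j, mdist (x j) (y j) < r) -> mpow_dist x y < r.
Proof. by move=> r0 h; apply: bigmax_lt => // j _; exact: h. Qed.

Lemma mpow_dist_ge0 (x y : mpow m Y) : 0 <= mpow_dist x y.
Proof. exact: bigmax_ge_id. Qed.

Lemma mpow_distxx (x : mpow m Y) : mpow_dist x x = 0.
Proof.
apply/eqP; rewrite eq_le mpow_dist_ge0 andbT mpow_dist_le// => j.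
by rewrite mdistxx.
Qed.

Lemma mpow_dist_positivity (x y : mpow m Y) : mpow_dist x y = 0 -> x = y.
Proof.
move=> xy; apply/ffunP => j; apply: mdist_positivity.
by apply/eqP; rewrite eq_le mdist_ge0 andbT -xy mpow_dist_ge.
Qed.

Lemma mpow_dist_sym (x y : mpow m Y) : mpow_dist x y = mpow_dist y x.
Proof. by apply: eq_bigr => j _; rewrite metric_sym. Qed.

Lemma mpow_dist_triangle (y x z : mpow m Y) :
  mpow_dist x z <= mpow_dist x y + mpow_dist y z.
Proof.
apply: mpow_dist_le => [|j]; first by rewrite addr_ge0 ?mpow_dist_ge0.
by rewrite (le_trans (metric_triangle _ (y j) _))// lerD ?mpow_dist_ge.
Qed.

HB.instance Definition _ := isMetric.Build R (mpow m Y)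
  mpow_distxx mpow_dist_positivity mpow_dist_sym mpow_dist_triangle.

End mpow_metric.

(* Levels are numbered from 0: [word I m k] is Omega_{k+1}. *)
Fixpoint word (I : Type) (m k : nat) : Type :=
  if k is k'.+1 then {ffun 'I_m -> word I m k'} else I.

(* The constant c of the metric and its bounds are parameters of the type, so
   that the metric can be inferred from it. *)
Definition code (R : realType) (I : Type) (m : nat) (c : R)
  (c01 : 0 < c < 1) : Type := forall k, word I m k.

Section code_metric.
Context (R : realType) (I : Type) (m : nat) (c : R) (c01 : 0 < c < 1).
Local Notation Omega := (code I m c01).

HB.instance Definition _ := gen_eqMixin Omega.
HB.instance Definition _ := gen_choiceMixin Omega.

Definition code_head (a : Omega) : I := a 0%N.

Definition code_tail (a : Omega) (j : 'I_m) : Omega := fun k => (a k.+1) j.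

Definition code_term (a b : Omega) (k : nat) : R :=
  c ^+ k.+1 * (`[< a k <> b k >])%:R.

Definition code_dist (a b : Omega) : R := limn (series (code_term a b)).

Let c_gt0 : 0 < c. Proof. by case/andP: c01. Qed.

Lemma code_term_ge0 a b k : 0 <= code_term a b k.
Proof. by rewrite mulr_ge0 ?exprn_ge0 ?ler0n// ltW. Qed.

Lemma is_cvg_code_series a b : cvgn (series (code_term a b)).
Proof.
apply: (@series_le_cvg _ _ (geometric c c)) => [k|k|k|].
- exact: code_term_ge0.
- by rewrite /geometric/= mulr_ge0 ?exprn_ge0// ltW.
- rewrite /geometric/= /code_term exprS ler_piMr//.
    by rewrite mulr_ge0 ?exprn_ge0// ltW.
  by case: asbool.
- apply: is_cvg_geometric_series; rewrite ger0_norm; last exact: ltW.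
  by case/andP: c01.
Qed.

Lemma code_psum_le a b n : series (code_term a b) n <= code_dist a b.
Proof.
apply: nondecreasing_cvgn_le; last exact: is_cvg_code_series.
by apply: nondecreasing_series => k _ _; exact: code_term_ge0.
Qed.

Lemma code_dist_le a b r :
  (forall n, series (code_term a b) n <= r) -> code_dist a b <= r.
Proof.
move=> h; apply: limr_le; first exact: is_cvg_code_series.
by apply: nearW => n; exact: h.
Qed.

Lemma code_dist_ge0 a b : 0 <= code_dist a b.
Proof.
by rewrite (le_trans _ (code_psum_le a b 0))// /series/= big_geq.
Qed.

Lemma code_term_le a b k : code_term a b k <= code_dist a b.
Proof.
rewrite (le_trans _ (code_psum_le a b k.+1))// /series/= big_nat_recr//=.
by rewrite lerDr sumr_ge0// => i _; exact: code_term_ge0.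
Qed.

Lemma code_distxx a : code_dist a a = 0.
Proof.
apply/eqP; rewrite eq_le code_dist_ge0 andbT code_dist_le// => n.
rewrite /series/= big1// => k _; rewrite /code_term.
by rewrite (asbool_equiv_eq (Q := False)) ?asboolF ?mulr0//; split.
Qed.

Lemma code_dist_lt_eq a b k : code_dist a b < c ^+ k.+1 -> a k = b k.
Proof.
move=> ab; apply: contrapT => neq; move: (code_term_le a b k).
by rewrite /code_term asboolT// mulr1 leNgt ab.
Qed.

Lemma code_dist_positivity a b : code_dist a b = 0 -> a = b.
Proof.
move=> ab; apply: functional_extensionality_dep => k.
by apply: code_dist_lt_eq; rewrite ab exprn_gt0.
Qed.

Lemma code_dist_sym a b : code_dist a b = code_dist b a.
Proof.
rewrite /code_dist; congr (limn (series _)); apply/funext => k.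
rewrite /code_term; congr (_ * (nat_of_bool _)%:R).
by apply: asbool_equiv_eq; split => + h; rewrite h.
Qed.

Lemma code_dist_triangle b a d :
  code_dist a d <= code_dist a b + code_dist b d.
Proof.
apply: code_dist_le => n.
rewrite (le_trans _ (lerD (code_psum_le a b n) (code_psum_le b d n)))//.
rewrite /series/= -big_split/= ler_sum// => k _.
rewrite /code_term -mulrDr ler_pM2l ?exprn_gt0// -natrD ler_nat.
case: asboolP => // ad; case: asboolP => //= ab; case: asboolP => // bd.
by exfalso; apply: ad; rewrite (contrapT ab) (contrapT bd).
Qed.

HB.instance Definition _ := isMetric.Build R Omega
  code_distxx code_dist_positivity code_dist_sym code_dist_triangle.

Lemma code_distE (a b : Omega) : mdist a b = code_dist a b.
Proof. by []. Qed.

Lemma code_tail_dist (a b : Omega) j :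
  c * mdist (code_tail a j) (code_tail b j) <= mdist a b.
Proof.
rewrite !code_distE -ler_pdivlMl// code_dist_le// => n; rewrite ler_pdivlMl//.
rewrite (le_trans _ (code_psum_le a b n.+1))// /series/= big_nat_recl//.
rewrite mulr_sumr ler_wpDl ?code_term_ge0// ler_sum// => k _.
rewrite /code_term mulrA -exprS ler_pM2l ?exprn_gt0// ler_nat.
case: asboolP => // neq; rewrite asboolT// => eq_ab; apply: neq.
by rewrite /code_tail eq_ab.
Qed.

Lemma code_tail_continuous j : continuous (fun a : Omega => code_tail a j).
Proof.
move=> a; apply/metric_continuousP => e e0; apply/nbhs_mdistP.
exists (c * e) => /=; first exact: mulr_gt0.
move=> b /= ab; rewrite -(ltr_pM2l c_gt0).
exact: le_lt_trans (code_tail_dist a b j) ab.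
Qed.

Lemma near_code_head (a : Omega) :
  \forall b \near a, code_head b = code_head a.
Proof.
apply/nbhs_mdistP; exists c => //= b ab.
by apply/esym/(@code_dist_lt_eq a b 0%N); rewrite expr1.
Qed.

End code_metric.

Record bcfun (R : realType) (T X : metricType R) := BCFun {
  bcfun_fun :> T -> X ;
  bcfun_continuous : continuous bcfun_fun ;
  bcfun_bounded : metric_bounded (range bcfun_fun)
}.

Section bcfun_metric.
Context (R : realType) (T X : metricType R).
Local Notation C := (bcfun T X).

HB.instance Definition _ := gen_eqMixin C.
HB.instance Definition _ := gen_choiceMixin C.

Definition bcfun_dist (f g : C) : R :=
  sup [set mdist (f t) (g t) | t in [set: T]].

Lemma bcfun_eq (f g : C) : (forall t, f t = g t) -> f = g.
Proof.
case: f g => [f fc fb] [g gc gb] /= /funext fg.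
move: gc gb; rewrite -fg => gc gb.
by congr BCFun; exact: Prop_irrelevance.
Qed.

Lemma bcfun_dist_has_ubound (f g : C) :
  has_ubound [set mdist (f t) (g t) | t in [set: T]].
Proof.
have [[t0 _]|T0] := pselect ([set: T] !=set0); last first.
  by exists 0 => y [t _ _]; exfalso; apply: T0; exists t.
have [Mf hf] := bcfun_bounded f; have [Mg hg] := bcfun_bounded g.
exists (Mf + (mdist (f t0) (g t0) + Mg)) => _ [t _ <-].
rewrite (le_trans (metric_triangle _ (f t0) _))// lerD//.
  by apply: hf; [exists t|exists t0].
rewrite (le_trans (metric_triangle _ (g t0) _))// lerD//.
by apply: hg; [exists t0|exists t].
Qed.

Lemma bcfun_dist_ge (f g : C) t : mdist (f t) (g t) <= bcfun_dist f g.
Proof. by apply: ub_le_sup; [exact: bcfun_dist_has_ubound|exists t]. Qed.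

Lemma bcfun_dist_le (f g : C) r : 0 <= r ->
  (forall t, mdist (f t) (g t) <= r) -> bcfun_dist f g <= r.
Proof.
move=> r0 h; rewrite /bcfun_dist; set A := [set _ | _ in _].
have [A0|/negP/negPn/eqP A0] := pselect (A != set0); last by rewrite A0 sup0.
by apply: ge_sup; [exact/set0P|move=> _ [t _ <-]].
Qed.

Lemma bcfun_dist_ge0 (f g : C) : 0 <= bcfun_dist f g.
Proof.
have [[t0 _]|T0] := pselect ([set: T] !=set0).
  exact: le_trans (mdist_ge0 _ _) (bcfun_dist_ge f g t0).
rewrite /bcfun_dist (_ : [set _ | _ in _] = set0) ?sup0//.
by apply/seteqP; split => // y [t _ _]; apply: T0; exists t.
Qed.

Lemma bcfun_distxx (f : C) : bcfun_dist f f = 0.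
Proof.
apply/eqP; rewrite eq_le bcfun_dist_ge0 andbT bcfun_dist_le// => t.
by rewrite mdistxx.
Qed.

Lemma bcfun_dist_positivity (f g : C) : bcfun_dist f g = 0 -> f = g.
Proof.
move=> fg; apply: bcfun_eq => t; apply: mdist_positivity.
by apply/eqP; rewrite eq_le mdist_ge0 andbT -fg bcfun_dist_ge.
Qed.

Lemma bcfun_dist_sym (f g : C) : bcfun_dist f g = bcfun_dist g f.
Proof.
rewrite /bcfun_dist; congr sup; apply: eq_imagel => t _.
exact: metric_sym.
Qed.

Lemma bcfun_dist_triangle (g f h : C) :
  bcfun_dist f h <= bcfun_dist f g + bcfun_dist g h.
Proof.
apply: bcfun_dist_le => [|t]; first by rewrite addr_ge0 ?bcfun_dist_ge0.
by rewrite (le_trans (metric_triangle _ (g t) _))// lerD ?bcfun_dist_ge.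
Qed.

HB.instance Definition _ := isMetric.Build R C
  bcfun_distxx bcfun_dist_positivity bcfun_dist_sym bcfun_dist_triangle.

End bcfun_metric.

(* Generalized possibly infinite iterated function systems of order m. *)
Record gIFS (R : realType) (X : metricType R) (I : Type) (m : nat) := GIFS {
  gIFS_fun :> I -> mpow m X -> X ;
  gIFS_continuous : forall i, continuous (gIFS_fun i) ;
  gIFS_bounded : forall B : set (mpow m X), metric_bounded B ->
    metric_bounded (\bigcup_i (gIFS_fun i @` B))
}.

Section gIFS_operator.
Context (R : realType) (X : metricType R) (I : Type) (m : nat).
Context (F : gIFS X I m) (c : R) (c01 : 0 < c < 1).
Local Notation Omega := (code I m c01).
Local Notation C := (bcfun Omega X).

Definition gIFS_op_fun (g : mpow m C) (a : Omega) : X :=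
  F (code_head a) [ffun j => g j (code_tail a j)].

Lemma gIFS_op_continuous (g : mpow m C) : continuous (gIFS_op_fun g).
Proof.
move=> a; apply/metric_continuousP => e e0.
have /metric_continuousP/(_ e e0)/nbhs_mdistP[r /= r0 Fr] :=
  @gIFS_continuous _ _ _ _ F (code_head a)
    ([ffun j => g j (code_tail a j)] : mpow m X).
have gr : \forall b \near a,
    forall j, mdist (g j (code_tail a j)) (g j (code_tail b j)) < r.
  apply: (@filter_forall _ _ _ (nbhs a)) => j.
  have /metric_continuousP : {for a, continuous (fun b => g j (code_tail b j))}.
    apply: (@continuous_comp _ _ _ (fun b : Omega => code_tail b j) (g j)).
      exact: code_tail_continuous.
    exact: bcfun_continuous.
  exact.
have hd := near_code_head a.
apply: filterS2 hd gr => b hd gr; rewrite /gIFS_op_fun hd; apply: Fr.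
by apply: mpow_dist_lt => // j; rewrite !ffunE.
Qed.

Lemma gIFS_op_bounded (g : mpow m C) : metric_bounded (range (gIFS_op_fun g)).
Proof.
pose B := [set x : mpow m X | forall j, range (g j) (x j)].
have /(gIFS_bounded F)[M hM] : metric_bounded B.
  have [N hN] := choice (fun j => bcfun_bounded (g j)).
  exists (\big[Num.max/0]_(j < m) N j) => x y Bx By.
  apply: mpow_dist_le => [|j]; first exact: bigmax_ge_id.
  exact: le_trans (hN j _ _ (Bx j) (By j)) (le_bigmax _ _ _).
have inB a : (\bigcup_i (F i @` B)) (gIFS_op_fun g a).
  exists (code_head a) => //; exists [ffun j => g j (code_tail a j)] => //.
  by move=> j; rewrite ffunE; exists (code_tail a j).
by exists M => _ _ [a _ <-] [b _ <-]; apply: hM.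
Qed.

Definition gIFS_op (g : mpow m C) : C :=
  BCFun (@gIFS_op_continuous g) (@gIFS_op_bounded g).

End gIFS_operator.

(* Main.v *)
Require Import Defs.
From mathcomp Require Import all_boot all_order all_algebra.
From mathcomp Require Import all_classical all_reals all_analysis.

Import Order.TTheory GRing.Theory Num.Theory.
Local Open Scope classical_set_scope.
Local Open Scope ring_scope.

(** At a code [a], two values of the operator are images under one and the
    same map [F (code_head a)], of the points with coordinates
    [g j (code_tail a j)] and [h j (code_tail a j)]; the coordinatewise
    distances of these points are at most the uniform distances of [g j] and
    [h j]. So a Lipschitz constant common to all the maps of the system is a
    Lipschitz constant of the operator ([gIFS_op_lipschitz]).

    A finite supremum of the numbers [lip (F i)] is such a common constant,
    because the infimum that defines [lip] is attained ([lip_leP]); an infinite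
    supremum bounds everything. The supremum is not [-oo] because it is taken
    over a nonempty family of nonnegative numbers. *)

Lemma lip_ge0 (R : realType) (Y Z : metricType R) (f : Y -> Z) :
  (0 <= lip f)%E.
Proof. by apply: le_ereal_inf_tmp => _ [k [k0 _] <-]; rewrite lee_fin. Qed.

(** From left to right, the infimum defining [lip f] is attained: at distinct
    points the quotient of the distances is a lower bound of all Lipschitz
    constants, hence of [lip f]. *)
Lemma lip_leP (R : realType) (Y Z : metricType R) (f : Y -> Z) (k : R) :
  0 <= k ->
  (lip f <= k%:E)%E <-> (forall x y, mdist (f x) (f y) <= k * mdist x y).
Proof.
move=> k0; split=> [fk x y|fk]; last by apply: ereal_inf_lbound; exists k.
have [xy0|xy0] := eqVneq (mdist x y) 0.
  by rewrite (mdist_positivity _ _ xy0) !mdistxx mulr0.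
have xy_gt0 : 0 < mdist x y by rewrite lt_def xy0 mdist_ge0.
rewrite -ler_pdivrMr// -lee_fin; apply: le_trans fk.
apply: le_ereal_inf_tmp => _ [l [_ fl] <-].
by rewrite lee_fin ler_pdivrMr.
Qed.

Lemma gIFS_op_lipschitz (R : realType) (X : metricType R) (I : Type) (m : nat)
  (c : R) (c01 : 0 < c < 1) (F : gIFS X I m) (k : R) :
  0 <= k ->
  (forall i x y, mdist (F i x) (F i y) <= k * mdist x y) ->
  forall g h, mdist (gIFS_op F (c01 := c01) g) (gIFS_op F (c01 := c01) h)
    <= k * mdist g h.
Proof.
move=> k0 Fk g h.
apply: bcfun_dist_le => [|a]; first by rewrite mulr_ge0 ?mdist_ge0.
apply: le_trans (Fk _ _ _) _; apply: ler_wpM2l => //.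
apply: mpow_dist_le => [|j]; first exact: mdist_ge0.
rewrite !ffunE.
exact: le_trans (bcfun_dist_ge (g j) (h j) _) (mpow_dist_ge g h j).
Qed.

Theorem proposition3p2 (R : realType) (X : metricType R) (I : Type) (m : nat)
  (X_neq0 : [set: X] !=set0) (I_neq0 : [set: I] !=set0) (m_gt0 : (0 < m)%N)
  (c : R) (c01 : 0 < c < 1) (F : gIFS X I m) :
  (lip (gIFS_op F (c01 := c01)) <= ereal_sup [set lip (F i) | i in [set: I]])%E
  /\ ((ereal_sup [set lip (F i) | i in [set: I]] < 1)%E ->
      (lip (gIFS_op F (c01 := c01)) < 1)%E).
Proof.
set S := ereal_sup _.
suff HS : (lip (gIFS_op F (c01 := c01)) <= S)%E.
  by split=> // S1; exact: le_lt_trans HS S1.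
have FS i : (lip (F i) <= S)%E by apply: ereal_sup_ubound; exists i.
have S0 : (0 <= S)%E.
  by have [i _] := I_neq0; exact: le_trans (lip_ge0 _ _ _ (F i)) (FS i).
move: S FS S0 => [s| |] FS S0; [|by rewrite leey|by []].
have s0 : 0 <= s by rewrite -lee_fin.
apply/lip_leP => //; apply: gIFS_op_lipschitz => // i.
by apply/lip_leP => //; exact: FS.
Qed.
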